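(* Suppose the random walk on $X$ induced by $\mu$ is uniquely ergodic, locally uniformly recurrent on average, and admits a Lyapunov function $V$. Let $\varphi:\mathbb{N}\to[1,\infty)$ have sub-exponential growth. Then for every $f\in C_c(X)$, $$\lim_{n\to\infty}\ \sup_{x\in X:\ V(x)\le\varphi(n)}\Big|\frac1n\sum_{k=0}^{n-1}\int_X f\,d(\mu^{*k}*\delta_x)-\int_X f\,dm_X\Big|=0.$$
   Context: Standing assumptions: $G$ is a locally compact $\sigma$-compact metrizable group acting ergodically on a locally compact $\sigma$-compact metrizable space $X$ with a $G$-invariant probability measure $m_X$; $\mu$ is a Borel probability measure on $G$; $\pi(\mu)F(x)=\int_G F(gx)\,d\mu(g)$; $\mu^{*n}*\delta_x$ is the push-forward of $\mu^{\otimes n}\otimes\delta_x$ under $(g_n,\dots,g_1,x)\mapsto g_n\cdots g_1x$. A probability measure $\nu$ is $\mu$-stationary if $\mu*\nu=\nu$; the random walk is uniquely ergodic if $m_X$ is the unique $\mu$-stationary probability measure. It is locally uniformly recurrent on average if for every compact $K$ and $\epsilon>0$ there are $n_0$ and compact $M$ with $\frac1n\sum_{k=0}^{n-1}\mu^{*k}*\delta_x(M)\ge1-\epsilon$ for all $n\ge n_0$, $x\in K$. A Lyapunov function is a proper continuous $V:X\to[0,\infty)$ with constants $\alpha<1$, $\beta\ge0$ such that $\pi(\mu)V\le\alpha V+\beta$. $\varphi$ has sub-exponential growth if $\limsup_{n\to\infty}\frac1n\log\varphi(n)=0$. *)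

(* Defs.v *)
From HB Require Import structures.
From mathcomp Require Import all_boot all_order all_algebra.
From mathcomp Require Import all_classical all_reals all_analysis.
Set Implicit Arguments. Unset Strict Implicit. Unset Printing Implicit Defensive.
Import Order.TTheory GRing.Theory Num.Theory.
Import numFieldNormedType.Exports.
Local Open Scope classical_set_scope.
Local Open Scope ring_scope.

Notation borel T := (g_sigma_algebraType (@open T)) (only parsing).

Definition loc_compact (T : topologicalType) : Prop :=
  forall x : T, exists K : set T, compact K /\ nbhs x K.

Definition sigma_compact (T : topologicalType) : Prop :=
  exists K : nat -> set T, (forall n, compact (K n)) /\ \bigcup_n K n = setT.

Definition proper_map (R : realType) (T : topologicalType) (V : T -> R) : Prop :=
  forall C : set R, compact C -> compact (V @^-1` C).

Definition Cc (R : realType) (T : topologicalType) (f : T -> R) : Prop :=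
  continuous f /\ compact (closure [set x | f x != 0]).

Definition topological_group (G : topologicalType)
    (mul : G -> G -> G) (inv : G -> G) (one : G) : Prop :=
  [/\ (forall a b c, mul a (mul b c) = mul (mul a b) c),
      (forall a, mul one a = a /\ mul a one = a),
      (forall a, mul (inv a) a = one /\ mul a (inv a) = one),
      continuous (fun p : G * G => mul p.1 p.2) &
      continuous inv].

Definition continuous_action (G X : ptopologicalType)
    (mul : G -> G -> G) (one : G) (act : G -> X -> X) : Prop :=
  [/\ (forall x, act one x = x),
      (forall g h x, act (mul g h) x = act g (act h x)) &
      continuous (fun p : G * X => act p.1 p.2)].

Local Open Scope ereal_scope.

Definition invariant_measure (R : realType) (G X : ptopologicalType)
    (act : G -> X -> X) (m : set (borel X) -> \bar R) : Prop :=
  forall (g : G) (A : set (borel X)), measurable A ->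
    m (act g @^-1` A) = m A.

Definition ergodic_action (R : realType) (G X : ptopologicalType)
    (act : G -> X -> X) (m : set (borel X) -> \bar R) : Prop :=
  forall A : set (borel X), measurable A ->
    (forall g : G, act g @^-1` A = A) -> m A = 0 \/ m A = 1.

(** Convolution mu * nu of a measure on G with a measure on X:
    (mu * nu)(A) = \int_G nu(g^{-1} A) dmu(g), i.e. the push-forward of
    mu (x) nu under (g, y) |-> g y. *)
Definition conv (R : realType) (G X : ptopologicalType) (act : G -> X -> X)
    (mu : set (borel G) -> \bar R) (nu : set (borel X) -> \bar R)
    : set (borel X) -> \bar R :=
  fun A => \int[mu]_(g in [set: borel G]) nu (act g @^-1` A).

Definition stationary (R : realType) (G X : ptopologicalType) (act : G -> X -> X)
    (mu : set (borel G) -> \bar R) (nu : set (borel X) -> \bar R) : Prop :=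
  forall A : set (borel X), measurable A -> conv act mu nu A = nu A.

Definition uniquely_ergodic (R : realType) (G X : ptopologicalType)
    (act : G -> X -> X) (mu : set (borel G) -> \bar R)
    (m : set (borel X) -> \bar R) : Prop :=
  forall nu : probability (borel X) R, stationary act mu nu ->
    forall A : set (borel X), measurable A -> nu A = m A.

(** rw act mu n x = mu^{*n} * delta_x :  mu^{*0} * delta_x = delta_x and
    mu^{*(n+1)} * delta_x = mu * (mu^{*n} * delta_x). *)
Fixpoint rw (R : realType) (G X : ptopologicalType) (act : G -> X -> X)
    (mu : set (borel G) -> \bar R) (n : nat) (x : X) : set (borel X) -> \bar R :=
  match n with
  | 0 => fun A => (\1_A x)%:E
  | n.+1 => conv act mu (rw act mu n x)
  end.

Definition loc_unif_recurrent_on_average (R : realType) (G X : ptopologicalType)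
    (act : G -> X -> X) (mu : set (borel G) -> \bar R) : Prop :=
  forall K : set X, compact K -> forall eps : R, (0 < eps)%R ->
    exists n0 : nat, exists M : set X, compact M /\
      forall n : nat, (n0 <= n)%N -> forall x : X, K x ->
        (n%:R^-1)%:E * (\sum_(k < n) rw act mu k x M) >= (1 - eps)%:E.

Definition lyapunov (R : realType) (G X : ptopologicalType) (act : G -> X -> X)
    (mu : set (borel G) -> \bar R) (V : X -> R) : Prop :=
  [/\ proper_map V, continuous V, (forall x, 0 <= V x)%R &
      exists alpha beta : R, [/\ (alpha < 1)%R, (0 <= beta)%R &
        forall x : X,
          \int[mu]_(g in [set: borel G]) (V (act g x))%:E
            <= (alpha * V x + beta)%:E]].

Definition subexponential (R : realType) (phi : nat -> R) : Prop :=
  limn_esup (fun n : nat => ((n%:R)^-1 * ln (phi n))%:E) = 0.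

(* Main.v *)
Require Import Defs.
From HB Require Import structures.
From mathcomp Require Import all_boot all_order all_algebra finmap.
From mathcomp Require Import all_classical all_reals all_analysis.
From mathcomp Require Import measurable_realfun.
From mathcomp Require Import ring lra zify.
Import Order.TTheory GRing.Theory Num.Theory.
Import numFieldNormedType.Exports.
Local Open Scope classical_set_scope.
Local Open Scope ring_scope.

(** After about n/q steps the Lyapunov drift has pulled every starting point with
    V x <= phi n = exp(o(n)) back to a point where V is bounded on average, at
    the cost of an error O(1/q) in the Cesaro average. It therefore suffices to
    have convergence uniformly on compact sets. If that fails, the Cesaro
    averages of the laws of the walk at offending points and times of a compact
    set are tight by recurrence; their limit along an ultrafilter is a
    probability measure, stationary because the averages are almost invariant
    and the Markov operator is Feller, and so equal to m_X: a contradiction.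
    The limit measure is built by hand from the finitely additive limit of the
    averages, by inner regularization on compact sets. *)

Set Implicit Arguments.
Unset Strict Implicit.

(** * Borel structure of a sigma-compact metric space *)

(** Each [K m] is covered by finitely many interiors of balls of radius [1/(n+1)]; over all [m] and
    [n] these form a countable base. *)
Lemma sigma_compact_second_countable {R : realType} {X : pseudoPMetricType R} :
  sigma_compact X -> @second_countable X.
Proof.
move=> [K [cK KT]].
pose f n (z : X) : set X := (ball z (n.+1%:R^-1 : R))°.
have h m n : finite_subset_cover [set: X] (f n) (K m).
  move: (cK m); rewrite compact_cover; apply.
  - by move=> z _; exact: open_interior.
  - by move=> z _; exists z => //; rewrite /f /interior; exact: nbhsx_ballx.
pose h' m n := projT1 (cid (iffLR (exists2P _ _) (h m n))).
exists (\bigcup_m \bigcup_n (f n) @` [set` h' m n]); [|split].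
- apply: bigcup_countable => // m _; apply: bigcup_countable => // n _.
  exact/finite_set_countable/finite_image/finite_fset.
- by move=> ? [? _ [? _ [? _ <-]]]; exact: open_interior.
- move=> x V /nbhs_ballP [] _/posnumP[eps] ballsubV.
  have [//|N] := @ltr_add_invr R 0%R (eps%:num/2) _; rewrite add0r => deleps.
  have [m _ Kmx] : (\bigcup_n K n) x by rewrite KT.
  have [w wh fx] : exists2 w : X, w \in h' m N & f N w x.
    rewrite /h'; case: cid => D /= [_ /(_ x Kmx)] [w ? ?].
    by exists w.
  exists (f N w); first by split => //; exists m => //; exists N => //; exists w.
  apply: (subset_trans _ ballsubV) => z bz.
  rewrite [_%:num]splitr; apply: (@ball_triangle _ _ w).
    by apply: (le_ball (ltW deleps)); apply/ball_sym; apply: interior_subset.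
  by apply: (le_ball (ltW deleps)); apply: interior_subset.
Qed.

(* Covering by countably many open rectangles makes continuity of the action
   enough for measurability with respect to the product sigma-algebra. *)
Lemma continuous_prod_measurable {G X Y : ptopologicalType} (a : G * X -> Y) :
  @second_countable X -> continuous a ->
  measurable_fun setT (a : borel G * borel X -> borel Y).
Proof.
move=> [B cB [oB bB]] ca.
apply: (@measurability _ _ (borel G * borel X)%type (borel Y) setT a (@open Y)) => //.
move=> _ [U oU <-]; rewrite setTI.
pose W := a @^-1` U.
have oW : open W by exact: open_comp.
(* Indexing the rectangles by [b] alone, with the largest admissible open set as first factor, is
   why a countable base of [X] suffices. *)
pose O (b : set X) : set G := \bigcup_(o in [set o | open o /\ o `*` b `<=` W]) o.
rewrite -/W.
have -> : W = \bigcup_(b in B) (O b `*` b).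
  apply/seteqP; split => [[g x] Wgx|[g x] [b Bb [Obg bx]]].
  - have : nbhs (g, x) W by exact: open_nbhs_nbhs.
    move=> [[/= P Q] [Pg Qx] PQW].
    have [b [Bb bx] bQ] := bB _ _ Qx.
    exists b => //; split => //=; exists P°; last first.
      exact: nbhs_singleton (nbhs_interior Pg).
    split; first exact: open_interior.
    move=> [g' x'] [/= Pg' bx']; apply: PQW; split => /=.
    + exact: interior_subset.
    + exact: bQ.
  - by case: Obg => o [_ obW] og; exact: obW.
have mO b : B b -> measurable (O b `*` b : set (borel G * borel X)).
  move=> Bb; apply: measurableX.
  - by apply: sub_sigma_algebra; apply: bigcup_open => o [].
  - by apply: sub_sigma_algebra; exact: oB.
rewrite (_ : \bigcup_(b in B) _ = \bigcup_b (if b \in B then O b `*` b else set0)).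
  have [->|B0] := eqVneq B set0.
    rewrite bigcup0 // => b _; rewrite ifN // notin_setE //.
  have /pfcard_geP[//|[e]] := cB.
    by move=> E; rewrite E eqxx in B0.
  rewrite -bigcup_mkcond (_ : \bigcup_(b in B) _ = \bigcup_n (O (e n) `*` e n)).
    by apply: bigcupT_measurable => n; apply: mO; exact: funS.
  apply/seteqP; split => [z [b Bb zb]|z [n _ zn]].
  - have [n _ enb] := 'surj_e Bb.
    by exists n => //; rewrite enb.
  - by exists (e n) => //; exact: funS.
by rewrite bigcup_mkcond.
Qed.

Lemma continuous_borel {R : realType} {X : ptopologicalType} (h : X -> R) :
  continuous h -> measurable_fun setT (h : borel X -> R).
Proof.
move=> ch; apply: (measurability _ (RGenOpens.measurableE R)).
move=> _ [_ [a [b ->]] <-]; rewrite setTI; apply: sub_sigma_algebra.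
by apply: open_comp => // x _; exact: ch.
Qed.

(** * The Markov operator of the random walk *)

Definition bounded_fun {T : Type} {R : realType} (h : T -> R) : Prop :=
  exists B, forall x, `|h x| <= B.

Definition bcont {R : realType} {X : topologicalType} (h : X -> R) : Prop :=
  continuous h /\ bounded_fun h.

Section unit_mass.
Context d (T : measurableType d) (R : realType) (m : {measure set T -> \bar R}).
Hypothesis m1 : m setT = 1%E.

Let mprob : set T -> \bar R := m.
HB.instance Definition _ := Measure.on mprob.
HB.instance Definition _ := Measure_isProbability.Build _ _ _ mprob m1.

(** Lets a measure of mass 1 serve where the type [probability] is required, as in
    [uniquely_ergodic]. *)
Lemma measure_probability : exists q : probability T R, m = q :> (set T -> \bar R).
Proof. by exists mprob. Qed.

End unit_mass.

Section bounded_integral.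
Context d {T : measurableType d} {R : realType} (p : probability T R).
Implicit Types h : T -> R.

Lemma bounded_integrable h : measurable_fun setT h -> bounded_fun h ->
  p.-integrable setT (EFin \o h).
Proof.
move=> mh [B hB]; apply: measurable_bounded_integrable => //.
  by rewrite /= probability_setT ltry.
exists B; split; first exact: num_real.
by move=> M BM x _ /=; exact: le_trans (hB x) (ltW BM).
Qed.

Lemma probability_Rintegral_cst (r : R) : \int[p]_x r = r.
Proof. by rewrite Rintegral_cst//= probability_setT mulr1. Qed.

Lemma EFin_Rintegral h : measurable_fun setT h -> bounded_fun h ->
  (\int[p]_x h x)%:E = (\int[p]_x (h x)%:E)%E.
Proof.
by move=> mh bh; rewrite fineK//; apply: integrable_fin_num => //;
  exact: bounded_integrable.
Qed.

Lemma Rintegral_bound h B : measurable_fun setT h ->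
  (forall x, `|h x| <= B) -> `|\int[p]_x h x| <= B.
Proof.
move=> mh hB; have ih : p.-integrable setT (EFin \o h).
  by apply: bounded_integrable => //; exists B.
apply: le_trans (le_normr_Rintegral _ ih) _ => //.
rewrite -[leRHS]probability_Rintegral_cst; apply: le_Rintegral => //.
- exact: (integrable_norm ih).
- by apply: bounded_integrable => //; exists `|B|.
Qed.

End bounded_integral.

Section markov_operator.
Context {R : realType} {G X : pseudoPMetricType R}.
Variables (act : G -> X -> X) (mu : probability (borel G) R).
Hypothesis cact : continuous (fun p : G * X => act p.1 p.2).
Hypothesis scX : sigma_compact X.

(** The domain carries the product of the Borel sigma-algebras, not the Borel sigma-algebra of the
    product topology, so that product measures apply. *)
Let uact : borel G * borel X -> borel X := fun p => act p.1 p.2.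

Let mact : measurable_fun setT uact.
Proof.
by apply: continuous_prod_measurable => //; exact: sigma_compact_second_countable.
Qed.

HB.instance Definition _ := isMeasurableFun.Build _ _ _ _ uact mact.

Lemma continuous_actr g : continuous (act g).
Proof.
move=> x; apply: (@continuous_comp _ _ _ (pair g) (fun p => act p.1 p.2)).
  by apply: cvg_pair => //=; exact: cvg_cst.
exact: cact.
Qed.

Lemma continuous_actl x : continuous (act ^~ x).
Proof.
move=> g; apply: (@continuous_comp _ _ _ (pair^~ x) (fun p => act p.1 p.2)).
  by apply: cvg_pair => //=; exact: cvg_cst.
exact: cact.
Qed.

(** The section at [g] of the preimage of [A] under [uact] is the preimage of [A] under [act g], so
    both sides are the same integral over [G]. *)
Lemma conv_pushforward (nu : probability (borel X) R) :
  Defs.conv act mu nu =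
  pushforward (mu \x nu)%E uact.
Proof.
apply/funext => A; rewrite /Defs.conv /pushforward /product_measure1.
apply: eq_integral => g _ /=; congr (nu _).
by apply/seteqP; split => x /=; rewrite /xsection /= inE.
Qed.

Lemma conv_probability (nu : probability (borel X) R) :
  exists q : probability (borel X) R, Defs.conv act mu nu = q.
Proof.
rewrite conv_pushforward; apply: measure_probability.
transitivity ((mu \x nu)%E (setT `*` setT)); first by rewrite setXTT.
by rewrite product_measure1E//= !probability_setT mule1.
Qed.

Lemma ge0_integral_conv (nu : probability (borel X) R) (h : X -> \bar R) :
  measurable_fun setT (h : borel X -> \bar R) -> (forall x, 0 <= h x)%E ->
  (\int[Defs.conv act mu nu]_(x in [set: borel X]) h x =
   \int[nu]_x \int[mu]_g h (act g x))%E.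
Proof.
move=> mh h0; rewrite conv_pushforward ge0_integral_pushforward//=.
rewrite preimage_setT fubini_tonelli2//=.
exact: measurableT_comp.
Qed.


Lemma measurable_integral_act (h : X -> \bar R) :
  measurable_fun setT (h : borel X -> \bar R) -> (forall x, 0 <= h x)%E ->
  measurable_fun setT
    ((fun x => \int[mu]_g h (act g x))%E : borel X -> \bar R).
Proof.
move=> mh h0.
apply: (measurable_fun_fubini_tonelli_G (m1 := mu) (h \o uact)) => //=.
exact: measurableT_comp.
Qed.

(** The operator [pi(mu)], real-valued since it serves bounded continuous functions; [V] is
    integrated in the extended reals instead. *)
Definition markov_op (h : X -> R) (x : X) : R := \int[mu]_g h (act g x).

Lemma bcont_measurable (h : X -> R) : bcont h ->
  measurable_fun setT (h : borel X -> R).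
Proof. by move=> [ch _]; exact: continuous_borel. Qed.

Lemma bcont_act_measurable (h : X -> R) x : bcont h ->
  measurable_fun setT ((fun g => h (act g x)) : borel G -> R).
Proof.
move=> [ch _]; apply: continuous_borel => g.
apply: (@continuous_comp _ _ _ (act^~ x) h); last exact: ch.
exact: continuous_actl.
Qed.

Lemma bcont_act_integrable (h : X -> R) x : bcont h ->
  mu.-integrable setT (fun g : borel G => (h (act g x))%:E).
Proof.
move=> bh; apply: (@bounded_integrable _ _ _ mu (fun g => h (act g x))).
  exact: bcont_act_measurable.
by case: bh => _ [B hB]; exists B => g; exact: hB.
Qed.

Lemma markov_op_bound (h : X -> R) B : bcont h -> (forall x, `|h x| <= B) ->
  forall x, `|markov_op h x| <= B.
Proof.
by move=> bh hB x; apply: Rintegral_bound => //; exact: bcont_act_measurable.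
Qed.

(** A failure of continuity at [x] gives a sequence [y n] tending to [x], and dominated convergence
    with the constant bound [B] contradicts it. *)
Lemma markov_op_feller (h : X -> R) : bcont h -> bcont (markov_op h).
Proof.
move=> bh; have [ch [B hB]] := bh.
split; last by exists B; exact: markov_op_bound.
move=> x; apply/cvgrPdist_lt => e e0; apply: contrapT => nbh.
have wit n : exists y, ball x (n.+1%:R^-1 : R) y /\
    ~ `|markov_op h x - markov_op h y| < e.
  apply: contrapT => no; apply: nbh; apply/nbhs_ballP.
  exists n.+1%:R^-1 => //= y xy; apply: contrapT => he.
  by apply: no; exists y.
have [y yP] := choice wit.
have yx : y @ \oo --> x.
  apply/cvg_ballP => d d0; near=> n.
  apply: le_ball (yP n).1; apply: ltW; near: n.
  exact: near_infty_natSinv_lt (PosNum d0).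
have cvgint : (fun n => \int[mu]_g (h (act g (y n)))%:E)%E @ \oo -->
    (\int[mu]_g (h (act g x))%:E)%E.
  apply: (@dominated_cvg _ _ _ mu [set: borel G] measurableT
      (fun n g => (h (act g (y n)))%:E) (fun g => (h (act g x))%:E) (cst B%:E)).
  - by move=> n; apply/measurable_EFinP; exact: bcont_act_measurable.
  - move=> g _; apply: cvg_EFin; first exact: nearW.
    have cx : {for x, continuous (h \o act g)}.
      by apply: continuous_comp; [exact: continuous_actr|exact: ch].
    exact: (continuous_cvg _ cx yx).
  - by [].
  - by apply: (@bounded_integrable _ _ _ mu (cst B)) => //; exists `|B|.
  - by move=> n g _; rewrite /= lee_fin.
have : (fun n => markov_op h (y n)) @ \oo --> markov_op h x.
  apply: fine_cvg; rewrite EFin_Rintegral//=.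
  - exact: bcont_act_measurable.
  - by exists B => g.
move/cvgrPdist_lt => /(_ e e0)[N _ /(_ N (leqnn N))].
by case: (yP N).
Unshelve. all: by end_near. Qed.

Lemma iter_markov_op_bcont (h : X -> R) k : bcont h ->
  bcont (iter k markov_op h).
Proof. by move=> bh; elim: k => //= k; exact: markov_op_feller. Qed.

Lemma iter_markov_op_bound (h : X -> R) B k : bcont h ->
  (forall x, `|h x| <= B) -> forall x, `|iter k markov_op h x| <= B.
Proof.
move=> bh hB; elim: k => //= k; apply: markov_op_bound.
exact: iter_markov_op_bcont.
Qed.

(** Tonelli's formula wants a nonnegative integrand: [h] is shifted by its bound [B], and the shift
    cancels because both measures have mass 1. *)
Lemma Rintegral_conv (nu q : probability (borel X) R) (h : X -> R) :
  Defs.conv act mu nu = q -> bcont h ->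
  \int[q]_x h x = \int[nu]_x markov_op h x.
Proof.
move=> qE bh; have [_ [B hB]] := bh.
have Bh x : 0 <= B + h x.
  by rewrite -lerBlDl sub0r; have := hB x; rewrite ler_norml => /andP[].
have mB : measurable_fun setT ((fun x => (B + h x)%:E) : borel X -> \bar R).
  apply/measurable_EFinP; apply: measurable_funD => //.
  exact: bcont_measurable.
have B0 : bounded_fun (cst B : X -> R) by exists `|B|.
have IBq : q.-integrable setT (EFin \o (cst B : borel X -> R)).
  by apply: bounded_integrable.
have IBn : nu.-integrable setT (EFin \o (cst B : borel X -> R)).
  by apply: bounded_integrable.
have Ihq : q.-integrable setT (EFin \o (h : borel X -> R)).
  by apply: bounded_integrable; [exact: bcont_measurable|exists B].
have IPn : nu.-integrable setT (EFin \o (markov_op h : borel X -> R)).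
  by have [? ?] := markov_op_feller bh; apply: bounded_integrable => //;
    exact: bcont_measurable.
suff : \int[q]_x (B + h x) = \int[nu]_x (B + markov_op h x).
  rewrite (RintegralD _ IBq Ihq)// (RintegralD _ IBn IPn)//.
  by rewrite !probability_Rintegral_cst => /addrI.
rewrite /Rintegral; congr fine.
rewrite -qE (@ge0_integral_conv nu (fun x => (B + h x)%:E))//.
apply: eq_integral => x _.
under eq_integral do rewrite EFinD.
rewrite integralD//=; last 2 first.
- by apply: (@bounded_integrable _ _ _ mu (cst B)) => //; exists `|B|.
- exact: bcont_act_integrable.
rewrite integral_cst//= probability_setT mule1 EFinD; congr (_ + _)%E.
rewrite /markov_op EFin_Rintegral//.
- exact: bcont_act_measurable.
- by exists B => g.
Qed.

Lemma rw_probability k x :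
  exists q : probability (borel X) R, rw act mu k x = q.
Proof.
elim: k => [|k [q qE]]; first by exists (dirac (x : borel X)).
by rewrite /= qE; exact: conv_probability.
Qed.

Definition rwp k x : probability (borel X) R := projT1 (cid (rw_probability k x)).

Lemma rwpE k x : rw act mu k x = rwp k x.
Proof. by rewrite /rwp; case: cid. Qed.

(** The newest step is the outermost convolution and acts on [h] first, so the induction on [k]
    keeps [h] general and passes to [markov_op h]. *)
Lemma Rintegral_rwp (h : X -> R) k x : bcont h ->
  \int[rwp k x]_y h y = iter k markov_op h x.
Proof.
elim: k h => [|k IH] h bh.
  rewrite /Rintegral -rwpE /= (_ : (fun A => _) = dirac (x : borel X))//.
  rewrite integral_dirac//=; first by rewrite indicT mul1r.
  by apply/measurable_EFinP; exact: bcont_measurable.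
rewrite (@Rintegral_conv (rwp k x))//; last by rewrite -rwpE -rwpE.
by rewrite IH -?iterSr//; exact: markov_op_feller.
Qed.

End markov_operator.

(** * Bounded continuous functions determine Borel probabilities *)

Section borel_determination.
Context {R : realType} {X : pseudoPMetricType R}.
Implicit Types (p q : probability (borel X) R) (h : X -> R).

Lemma open_borel (O : set X) : open O -> measurable (O : set (borel X)).
Proof. exact: sub_sigma_algebra. Qed.

Lemma closed_borel (F : set X) : closed F -> measurable (F : set (borel X)).
Proof.
by move=> cF; rewrite -[F]setCK; apply: measurableC; apply: open_borel; exact: closed_openC cF.
Qed.

(** [F n] omits the points within about [1/(n+1)] of the complement of [O]; taking interiors of the
    balls makes it closed. *)
Lemma open_Fsigma (O : set X) : open O -> exists F : (set X)^nat,
  [/\ forall n, closed (F n), nondecreasing_seq F & \bigcup_n F n = O].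
Proof.
move=> oO; exists (fun n => ~` \bigcup_(y in ~` O) (ball y (n.+1%:R^-1 : R))°).
split.
- by move=> n; apply/open_closedC/bigcup_open => y _; exact: open_interior.
- move=> m n mn; apply/subsetPset/subsetC => x [y Oy yx].
  exists y => //; apply: interiorS yx; apply: le_ball.
  by rewrite lef_pV2 ?posrE// ler_nat ltnS.
- apply/seteqP; split => [x [n _]|x Ox].
  + apply: contra_notP => nOx; exists x => //.
    exact: nbhsx_ballx.
  + have /nbhs_ballP[e /= e0 eO] : nbhs x O by exact: open_nbhs_nbhs.
    have [n _ /(_ n (leqnn n)) ne] := near_infty_natSinv_lt (PosNum e0).
    exists n => // -[y nOy /interior_subset yx]; apply: nOy; apply: eO.
    exact/ball_sym/(le_ball (ltW ne)).
Qed.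

Lemma indicator_le_integral p (A : set X) h : measurable (A : set (borel X)) ->
  measurable_fun setT (h : borel X -> R) ->
  (forall x, \1_A x <= h x) -> (p A <= \int[p]_x (h x)%:E)%E.
Proof.
move=> mA mh Ah; rewrite -[A]setIT -integral_indic//; apply: ge0_le_integral => //=.
- exact/measurable_EFinP/measurable_indic.
- exact/measurable_EFinP.
- by move=> x _; rewrite lee_fin.
Qed.

Lemma integral_le_indicator p (A : set X) h : measurable (A : set (borel X)) ->
  measurable_fun setT (h : borel X -> R) -> (forall x, 0 <= h x) ->
  (forall x, h x <= \1_A x) -> (\int[p]_x (h x)%:E <= p A)%E.
Proof.
move=> mA mh h0 hA; rewrite -[A]setIT -integral_indic//; apply: ge0_le_integral => //=.
- by move=> x _; rewrite lee_fin.
- exact/measurable_EFinP.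
- exact/measurable_EFinP/measurable_indic.
- by move=> x _; rewrite lee_fin.
Qed.

Lemma closed_in_open_bump (F O : set X) : closed F -> open O -> F `<=` O ->
  exists h : X -> R, [/\ continuous h, forall x, 0 <= h x <= 1,
    forall x, \1_F x <= h x & forall x, h x <= \1_O x].
Proof.
move=> cF oO FO.
have /(@uniform_separatorP _ R)[h [ch h01 h0 h1]] : uniform_separator (~` O) F.
  have /(@normal_separatorP R) ns : normal_space X by exact: pseudometric_normal.
  apply: ns => //.
  - exact: open_closedC.
  - by apply/seteqP; split => // x [nO Fx]; exact/nO/FO.
have hx x : 0 <= h x <= 1 by have /h01 := imageT h x; rewrite /= in_itv.
exists h; split => // x.
- rewrite indicE; case: (boolP (x \in F)) => [/set_mem Fx|_]; last by case/andP: (hx x).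
  by rewrite mulr1n (_ : h x = 1)//; apply: h1; exists x.
- rewrite indicE; case: (boolP (x \in O)) => [_|]; first by case/andP: (hx x).
  rewrite notin_setE => nOx.
  by rewrite mulr0n (_ : h x = 0)//; apply: h0; exists x.
Qed.

(** With a bump [h] between [F n] and [O], [p (F n)] is at most the common integral of [h], hence at
    most [q O]; then [F n] increases to [O]. *)
Lemma bcont_open_le p q : (forall h, bcont h -> \int[p]_x h x = \int[q]_x h x) ->
  forall O : set X, open O -> (p O <= q O)%E.
Proof.
move=> pq O oO; have [F [cF ndF FO]] := open_Fsigma oO.
have : p (F n) @[n --> \oo] --> p O.
  rewrite -FO; apply: nondecreasing_cvg_mu => //.
  - by move=> n; exact: closed_borel.
  - by rewrite FO; exact: open_borel.
move/cvg_lim => <- //; apply: lime_le.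
  apply: ereal_nondecreasing_is_cvgn => m n mn; apply: le_measure => //.
  - by rewrite inE; exact: closed_borel.
  - by rewrite inE; exact: closed_borel.
  - exact/subsetPset/ndF.
apply: nearW => n.
have [|h [ch h01 Fh hO]] := closed_in_open_bump (cF n) oO.
  by rewrite -FO; exact: bigcup_sup.
have bh : bounded_fun h.
  by exists 1 => x; case/andP: (h01 x) => h0 h1; rewrite ger0_norm.
have mh := continuous_borel ch.
apply: le_trans (indicator_le_integral p (closed_borel (cF n)) mh Fh) _.
rewrite -EFin_Rintegral// pq// EFin_Rintegral//.
apply: integral_le_indicator => //; first exact: open_borel.
by move=> x; case/andP: (h01 x).
Qed.

(** Open sets are a generating family stable under intersection, and the hypothesis is symmetric in
    [p] and [q]. *)
Lemma bcont_determines p q : (forall h, bcont h -> \int[p]_x h x = \int[q]_x h x) ->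
  forall A : set (borel X), measurable A -> p A = q A.
Proof.
move=> pq.
apply: (@measure_unique _ R (borel X) (@open X) (fun=> setT) _ _ _ _ p q) => //.
- exact: openI.
- by move=> _; exact: openT.
- by apply/seteqP; split => // x _; exists 0%N.
- move=> A oA; apply/eqP; rewrite eq_le; apply/andP; split.
    exact: (bcont_open_le pq).
  apply: (@bcont_open_le q p _ _ oA) => h bh.
  by rewrite pq.
- by move=> _; apply: le_lt_trans (probability_le1 p measurableT) _; exact: ltry.
Qed.

End borel_determination.

(** * Regularization of a tight finitely additive probability *)

Lemma compact_borel {R : realType} {X : pseudoPMetricType R} (K : set X) :
  hausdorff_space X -> compact K -> measurable (K : set (borel X)).
Proof. by move=> hX cK; apply: closed_borel; exact: compact_closed. Qed.

(** The parts of [K] outside [U] and outside [V] are disjoint closed sets; removing disjoint open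
    neighbourhoods of them from [K] leaves the two pieces. *)
Lemma compact_split {R : realType} {X : pseudoPMetricType R} (K U V : set X) :
  hausdorff_space X -> compact K -> open U -> open V -> K `<=` U `|` V ->
  exists K1 K2, [/\ compact K1, compact K2, K1 `<=` U, K2 `<=` V & K = K1 `|` K2].
Proof.
move=> hX cK oU oV KUV; have clK := compact_closed hX cK.
have /(@normal_openP R) ns : normal_space X by exact: pseudometric_normal.
have [| | |W1 [W2 [ opW1 opW2 KO1 KO2 O12]]] := ns (K `\` U) (K `\` V).
- by apply: closedI => //; exact: open_closedC.
- by apply: closedI => //; exact: open_closedC.
- apply/seteqP; split => // x [[Kx nUx] [_ nVx]].
  by case: (KUV _ Kx).
have cD W : open W -> compact (K `\` W).
  move=> opW; apply: (@subclosed_compact _ _ K) => //.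
  by apply: closedI => //; exact: open_closedC.
exists (K `\` W1), (K `\` W2); split; [exact: cD|exact: cD| | | ].
- by move=> x [Kx nO1]; apply: contrapT => nU; exact/nO1/KO1.
- by move=> x [Kx nO2]; apply: contrapT => nV; exact/nO2/KO2.
- apply/seteqP; split => [x Kx|x [[]|[]]//].
  have [W1x|nW1x] := pselect (W1 x); last by left.
  by right; split => // W2x; have : (W1 `&` W2) x by []; rewrite O12.
Qed.

Section content_regularization.
Context {R : realType} {X : pseudoPMetricType R}.
Hypothesis hX : hausdorff_space X.
Variable lam : set (borel X) -> R.
Hypothesis lam_ge0 : forall A, measurable A -> 0 <= lam A.
Hypothesis lamU : forall A B, measurable A -> measurable B -> A `&` B = set0 ->
  lam (A `|` B) = lam A + lam B.
Hypothesis lamT : lam setT = 1.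
Hypothesis lam_tight : forall e : R, 0 < e ->
  exists2 M : set X, compact M & 1 - e <= lam M.

Let lam0 : lam set0 = 0.
Proof.
have := lamU (@measurable0 _ (borel X)) (@measurable0 _ (borel X)) (setI0 _).
by rewrite setU0 -[LHS]addr0 => /addrI.
Qed.

Let le_lam A B : measurable A -> measurable B -> A `<=` B -> lam A <= lam B.
Proof.
move=> mA mB AB; rewrite -(setDUK AB) lamU ?setDIK//; last exact: measurableD.
by rewrite lerDl lam_ge0//; exact: measurableD.
Qed.

Let lamU_le A B : measurable A -> measurable B -> lam (A `|` B) <= lam A + lam B.
Proof.
move=> mA mB; have -> : A `|` B = A `|` (B `\` A) by rewrite setDE setUIr setUv setIT.
rewrite lamU//; last 2 first.
- exact: measurableD.
- by rewrite setDIK.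
by rewrite lerD2l le_lam//; exact: measurableD.
Qed.

(** [lam] is only finitely additive. Testing open sets by their compact subsets restores countable
    subadditivity, since finite subcovers suffice. *)
Let inner (W : set X) : \bar R :=
  ereal_sup [set (lam K)%:E | K in [set K : set X | compact K /\ K `<=` W]].

Let outer (A : set X) : \bar R :=
  ereal_inf [set inner W | W in [set W : set X | open W /\ A `<=` W]].

Let le_inner (K W : set X) : compact K -> K `<=` W -> ((lam K)%:E <= inner W)%E.
Proof. by move=> cK KO; apply: ereal_sup_ubound; exists K. Qed.

Let inner_ge0 W : (0 <= inner W)%E.
Proof.
have <- : (lam set0)%:E = 0%E by rewrite lam0.
by apply: le_inner => //; exact: compact0.
Qed.

Let inner_le1 W : (inner W <= 1)%E.
Proof.
apply: ge_ereal_sup => _ [K [cK KO] <-]; 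
by rewrite lee_fin -lamT le_lam//; exact: compact_borel.
Qed.

Let le_inner2 W W' : W `<=` W' -> (inner W <= inner W')%E.
Proof.
move=> OO'; apply: ge_ereal_sup => _ [K [cK KO] <-].
by apply: le_inner => //; exact: subset_trans OO'.
Qed.

Let inner_le_lam (W : set X) : open W -> (inner W <= (lam W)%:E)%E.
Proof.
move=> opW; apply: ge_ereal_sup => _ [K [cK KO] <-].
by rewrite lee_fin le_lam//; [exact: compact_borel|exact: open_borel].
Qed.

Let inner_fin W : inner W \is a fin_num.
Proof.
by rewrite ge0_fin_numE//; apply: le_lt_trans (inner_le1 W) _; exact: ltry.
Qed.

Let outerE (W : set X) : open W -> outer W = inner W.
Proof.
move=> opW; apply/eqP; rewrite eq_le; apply/andP; split.
  by apply: ereal_inf_lbound; exists W => //; split.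
by apply: le_ereal_inf_tmp => _ [W' [_ OO'] <-]; exact: le_inner2.
Qed.

Let outer_ge0 A : (0 <= outer A)%E.
Proof. by apply: le_ereal_inf_tmp => _ [W' _ <-]. Qed.

Let outer0 : outer set0 = 0%E.
Proof.
rewrite outerE; last exact: open0.
apply/eqP; rewrite eq_le inner_ge0 andbT.
by apply: ge_ereal_sup => _ [K [_ +] <-]; rewrite subset0 => ->; rewrite lam0.
Qed.

Let le_outer : {homo outer : A B / A `<=` B >-> (A <= B)%E}.
Proof.
move=> A B AB; apply: ereal_inf_le_tmp => _ [W [ opW BO] <-].
by exists W => //; split => //; exact: subset_trans BO.
Qed.

Let outer_fin A : outer A \is a fin_num.
Proof.
rewrite ge0_fin_numE//; apply: le_lt_trans (le_outer (@subsetT _ A)) _.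
by rewrite outerE ?ltey_eq ?inner_fin//; exact: openT.
Qed.

(** Each use of [compact_split] cuts off a compact piece lying in the last [W i] and leaves a
    compact set covered by the earlier ones. *)
Let inner_bigU (W : (set X)^nat) : (forall n, open (W n)) ->
  forall N (K : set X), compact K -> K `<=` \bigcup_(i < N) W i ->
  ((lam K)%:E <= \sum_(i < N) inner (W i))%E.
Proof.
move=> opW; elim=> [K cK KO|N IH K cK].
  rewrite big_ord0 (_ : K = set0) ?lam0//.
  by rewrite -subset0 => x /KO [].
rewrite bigcup_mkord big_ord_recr/= -bigcup_mkord => KO.
have [|K1 [K2 [cK1 cK2 K1O K2O KE]]] := compact_split hX cK _ (opW N) KO.
  by apply: bigcup_open => i _.
rewrite big_ord_recr /=; apply: (@le_trans _ _ ((lam K1)%:E + (lam K2)%:E)%E).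
  by rewrite -EFinD lee_fin KE lamU_le//; exact: compact_borel.
by apply: leeD; [exact: IH|exact: le_inner].
Qed.

Let inner_bigcup (W : (set X)^nat) : (forall n, open (W n)) ->
  (inner (\bigcup_n W n) <= \sum_(n <oo) inner (W n))%E.
Proof.
move=> opW; apply: ge_ereal_sup => _ [K [cK KO] <-].
have [D _ KD] : finite_subset_cover [set: nat] W K.
  by move: cK; rewrite compact_cover; apply.
pose N := (\max_(i <- D) i).+1.
apply: (@le_trans _ _ (\sum_(i < N) inner (W i))%E).
  apply: inner_bigU => // x /KD [i iD Wix].
  by exists i => //=; rewrite ltnS; exact: (@leq_bigmax_seq _ _ _ (fun i => i)).
rewrite -(big_mkord xpredT (fun i => inner (W i))).
exact: nneseries_lim_ge.
Qed.

(** Open supersets [W n] that are optimal up to [e / 2 ^ n.+1] reduce the claim to open sets, and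
    the errors add up to at most [e]. *)
Let outer_sigma_subadditive : sigma_subadditive outer.
Proof.
move=> F; apply/lee_addgt0Pr => e e0.
have wit n : exists W, [/\ open W, F n `<=` W &
    (inner W <= outer (F n) + (e / (2 ^ n.+1)%:R)%:E)%E].
  have en : 0 < e / (2 ^ n.+1)%:R by rewrite divr_gt0// ltr0n expn_gt0.
  have [_ [W [ opW FO] <-] Oe] := lb_ereal_inf_adherent en (outer_fin (F n)).
  by exists W; split => //; exact: ltW.
have [W WP] := choice wit.
apply: (@le_trans _ _ (\sum_(n <oo) (outer (F n) + (e / (2 ^ n.+1)%:R)%:E))%E).
  apply: (@le_trans _ _ (\sum_(n <oo) inner (W n))%E).
    apply: le_trans (inner_bigcup _); last by move=> n; case: (WP n).
    rewrite -outerE; last by apply: bigcup_open => n _; case: (WP n).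
    by apply: le_outer; apply: subset_bigcup => n _; case: (WP n).
  by apply: lee_nneseries => // n _; case: (WP n).
by apply: epsilon_trick => //; exact: ltW.
Qed.

HB.instance Definition _ := isOuterMeasure.Build R X outer
  outer0 outer_ge0 le_outer outer_sigma_subadditive.

(** For open [W] around [Y], a compact [K] inside both [W] and [A] and a compact [K'] inside [W] but
    off [K] are disjoint, so [lam K + lam K'] is at most [inner W]. Suprema over [K'], then over
    [K], give the claim. *)
Let open_caratheodory (A : set X) : open A -> outer.-caratheodory A.
Proof.
move=> oA; apply: le_caratheodory_measurable => Y.
apply: le_ereal_inf_tmp => _ [W [ opW YO] <-].
apply: (@le_trans _ _ (outer (W `&` A) + outer (W `&` ~` A))%E).
  by apply: leeD; apply: le_outer; exact: setSI.
rewrite outerE; last exact: openI.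
rewrite -leeBrDr//; apply: ge_ereal_sup => _ [K [cK KOA] <-].
rewrite leeBrDr// -leeBrDl//.
apply: (@le_trans _ _ (inner (W `&` ~` K))).
  rewrite -outerE; last first.
    by apply: openI => //; apply: closed_openC; exact: compact_closed.
  apply: le_outer; apply: setIS; apply: subsetC => x /KOA[].
  by [].
apply: ge_ereal_sup => _ [K' [cK' KO'] <-].
rewrite leeBrDl// -EFinD -lamU; [|exact: compact_borel|exact: compact_borel|].
- apply: le_inner; first exact: compactU.
  by move=> x [/KOA[]|/KO'[]].
- by apply/seteqP; split => // x [Kx /KO'[_]].
Qed.

Let borel_caratheodory (A : set (borel X)) : measurable A -> outer.-caratheodory A.
Proof.
have : <<s @open X >> `<=` (outer.-cara.-measurable : set (set X)).
  apply: smallest_sub; last by move=> W; exact: open_caratheodory.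
  exact: sigma_algebra_measurable.
exact.
Qed.

Let mouter : set (borel X) -> \bar R := outer.

Let mouter_sigma_additive : semi_sigma_additive mouter.
Proof.
move=> F mF tF mUF.
apply: (@caratheodory_measure_sigma_additive R X outer) => //.
- by move=> n; exact: borel_caratheodory.
- exact: borel_caratheodory.
Qed.

HB.instance Definition _ := isMeasure.Build _ (borel X) R mouter
  outer0 outer_ge0 mouter_sigma_additive.

(** Tightness enters here: it keeps mass from escaping every compact set. *)
Let mouterT : mouter setT = 1%E.
Proof.
rewrite /mouter outerE; last exact: openT.
apply/eqP; rewrite eq_le inner_le1/=; apply/lee_addgt0Pr => e e0.
have [M cM Me] := lam_tight e0.
rewrite -leeBlDr//; apply: le_trans (le_inner cM (@subsetT _ M)).
by rewrite -EFinB lee_fin.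
Qed.

(* The Borel measure is the outer measure A |-> inf over open W containing A of
   sup over compact K inside W of lam K. *)
Lemma tight_content_regularization : exists q : probability (borel X) R,
  forall W : set X, open W -> (q W <= (lam W)%:E)%E.
Proof.
have [q qE] := measure_probability mouterT.
exists q => W opW; rewrite -qE.
by rewrite [leLHS]outerE//; exact: inner_le_lam.
Qed.

End content_regularization.

(** * Weak limits along an ultrafilter *)

(** The image ultrafilter lives on the compact segment from [- B] to [B], so it clusters at some
    [l]; an ultrafilter converges to its cluster points. *)
Lemma ultra_bounded_cvg {R : realType} {I : Type} (U : set_system I)
    (u : I -> R) (B : R) :
  UltraFilter U -> (forall i, `|u i| <= B) -> cvg (u @ U).
Proof.
move=> UU uB; have cI := @segment_compact R (- B) B.
have [|l [_ lu]] := cI (u @ U) _.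
  by apply: nearW => i; rewrite /= in_itv/= -ler_norml.
apply/cvg_ex; exists l; apply/cvgrPdist_lt => e e0.
have [//|Un] := in_ultra_setVsetC [set i | `|l - u i| < e] UU.
by have [z []] := lu (~` ball l e) (ball l e) Un (nbhsx_ballx _ _ e0).
Qed.

(** The sum counts the integers [i < N] below [y], so it is the minimum of [N] and the ceiling of
    [y]. It is a layer-cake approximation that turns bounds on open sets into bounds on
    integrals. *)
Lemma staircase_bounds {R : realType} (N : nat) (y : R) : 0 <= y ->
  let s := \sum_(i < N) (i%:R < y)%R%:R : R in
  [/\ Num.min y N%:R <= s, s <= N%:R & s <= y + 1].
Proof.
move=> y0; elim: N => [|N [lo up1 up2]] /=.
  by rewrite big_ord0 ge_min lexx orbT; split => //; rewrite addr_ge0.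
rewrite big_ord_recr/=; set s := \sum_(i < N) _ in lo up1 up2 *.
have [Ny|yN] := ltrP N%:R y; last first.
  rewrite addr0; split=> //; last by rewrite -natr1 (le_trans up1)// lerDl.
  by apply: le_trans lo; rewrite le_min !ge_min lexx yN.
rewrite -natr1; split; [|by rewrite lerD2r|by rewrite lerD2r (le_trans up1)// ltW].
rewrite ge_min; apply/orP; right; rewrite lerD2r.
by move: lo; rewrite ge_min leNgt => /orP[|//]; move: up1 Ny; lra.
Qed.

Section indicator_sums.
Context d (T : measurableType d) (R : realType) (p : probability T R).

Lemma sum_indic_integrable (A : (set T)^nat) N : (forall i, measurable (A i)) ->
  p.-integrable setT (EFin \o (fun x => \sum_(i < N) (\1_(A i) x : R))).
Proof.
move=> mA; apply: (bounded_integrable p).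
  by apply: measurable_sum => i; exact: measurable_indic.
exists N%:R => x; rewrite ger0_norm ?sumr_ge0//.
rewrite -[leRHS](_ : \sum_(i < N) 1 = _); last by rewrite sumr_const card_ord.
by apply: ler_sum => i _; rewrite indicE; case: (_ \in _).
Qed.

Lemma Rintegral_sum_indic (A : (set T)^nat) N : (forall i, measurable (A i)) ->
  \int[p]_x (\sum_(i < N) (\1_(A i) x : R)) = \sum_(i < N) fine (p (A i)).
Proof.
move=> mA; elim: N => [|N IH].
  under eq_Rintegral do rewrite big_ord0.
  by rewrite probability_Rintegral_cst big_ord0.
under eq_Rintegral do rewrite big_ord_recr/=.
rewrite RintegralD//.
- rewrite IH big_ord_recr/=; congr (_ + _).
  by rewrite /Rintegral integral_indic// setIT.
- exact: sum_indic_integrable.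
- apply: (bounded_integrable p); first exact: measurable_indic.
  by exists 1 => x; rewrite indicE; case: (_ \in _); rewrite ?normr1 ?normr0.
Qed.

Lemma Rintegral_affine (h : T -> R) (a b : R) : measurable_fun setT h ->
  bounded_fun h -> \int[p]_x (a * h x + b) = a * \int[p]_x h x + b.
Proof.
move=> mh bh; have ih := bounded_integrable p mh bh.
rewrite RintegralD//.
- by rewrite RintegralZl// probability_Rintegral_cst.
- by have := integrableZl measurableT a ih.
- by apply: (@bounded_integrable _ _ _ p (cst b)) => //; exists `|b|.
Qed.

End indicator_sums.

Section tight_ultralimit.
Context {R : realType} {X : pseudoPMetricType R}.
Hypothesis hX : hausdorff_space X.
Variables (p : nat -> probability (borel X) R) (U : set_system nat).
Hypothesis UU : UltraFilter U.
Hypothesis tight : forall e : R, 0 < e -> exists2 M : set X, compact M &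
  \forall j \near U, 1 - e <= fine (p j M).

(** Countable additivity may be lost along [U], which is why the limit has to be regularized. *)
Let lam (A : set (borel X)) : R := lim (fine (p j A) @[j --> U]).

Let prob01 j A : measurable A -> 0 <= fine (p j A) <= 1.
Proof.
move=> mA; rewrite fine_ge0//= -lee_fin fineK ?fin_num_measure//.
exact: probability_le1.
Qed.

Let lamP A : measurable A -> fine (p j A) @[j --> U] --> lam A.
Proof.
move=> mA; apply: (@ultra_bounded_cvg _ _ _ _ 1) => j.
by have /andP[p0 p1] := prob01 j mA; rewrite ger0_norm.
Qed.

Let ultralimit_opens : exists q : probability (borel X) R,
  forall O : set X, open O -> fine (q O) <= lam O.
Proof.
have [|||e e0|q qle] := @tight_content_regularization _ _ hX lam.
- move=> A mA; apply: limr_ge; first exact: lamP.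
  by apply: nearW => j; case/andP: (prob01 j mA).
- move=> A B mA mB AB; apply: cvg_lim => //.
  rewrite (_ : (fun j => _) = (fun j => fine (p j A) + fine (p j B))).
    by apply: cvgD; exact: lamP.
  apply/funext => j; rewrite measureU// fineD ?fin_num_measure//.
- apply: cvg_lim => //; rewrite (_ : (fun j => _) = cst 1); first exact: cvg_cst.
  by apply/funext => j; rewrite probability_setT.
- have [M cM Me] := tight e0; exists M => //.
  by apply: limr_ge => //; apply: lamP; exact: compact_borel.
exists q => W opW; rewrite -lee_fin fineK ?fin_num_measure//; last exact: open_borel.
exact: qle.
Qed.

(** The one-sided bound on open sets is enough: layer-cake sums give one inequality for continuous
    [h] with values in [[0, 1]], the same applied to [1 - h] gives the other, and an affine change
    of [h] covers the bounded case. *)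
Lemma tight_ultralimit : exists q : probability (borel X) R,
  forall h : X -> R, bcont h -> (\int[p j]_x h x) @[j --> U] --> \int[q]_x h x.
Proof.
have [q qlam] := ultralimit_opens; exists q.
have cvgp (h : X -> R) (B : R) : measurable_fun setT (h : borel X -> R) ->
    (forall x, `|h x| <= B) -> cvg (\int[p j]_x h x @[j --> U]).
  by move=> mh hB; apply: (@ultra_bounded_cvg _ _ _ _ B) => j; exact: Rintegral_bound.
have le_lim (h : X -> R) : continuous h -> (forall x, 0 <= h x <= 1) ->
    \int[q]_x h x <= lim (\int[p j]_x h x @[j --> U]).
  move=> ch h01; set L := lim _.
  have mh := continuous_borel ch.
  have hb x : `|h x| <= 1 by case/andP: (h01 x) => ? ?; rewrite ger0_norm.
  have bh : bounded_fun h by exists 1.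
  (* N h is sandwiched between s - 1 and s, where s x counts the i < N with
     i < N h x, i.e. the open sets A i to which x belongs. *)
  suff NL N : N%:R * \int[q]_x h x <= N%:R * L + 1.
    (* After division by [N.+1] the error 1 is too small to bridge a gap between [L] and the
       integral. *)
    rewrite leNgt; apply/negP => Lq.
    have [N] := @ltr_add_invr R L _ Lq; have := NL N.+1.
    have N0 : 0 < N.+1%:R :> R by rewrite ltr0n.
    rewrite -(ltr_pM2l N0) mulrDr divff ?gt_eqF// => h1 h2.
    by move: (lt_le_trans h2 h1); rewrite ltxx.
  pose A i : set X := [set x | i%:R < N%:R * h x].
  have opA i : open (A i).
    apply: (@open_comp _ _ (fun x => N%:R * h x) [set y | i%:R < y]).
      by move=> x _; apply: cvgM; [exact: cvg_cst|exact: ch].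
    exact: open_gt.
  have mA i : measurable (A i : set (borel X)) by exact: open_borel.
  have sE x : \sum_(i < N) (\1_(A i) x : R) =
      \sum_(i < N) (i%:R < N%:R * h x)%R%:R.
    by apply: eq_bigr => i _; rewrite indicE mem_setE.
  have st x := @staircase_bounds R N (N%:R * h x)
    (mulr_ge0 (ler0n _ _) (andP (h01 x)).1).
  have mNh b : measurable_fun setT (fun x : borel X => N%:R * h x + b).
    by apply: measurable_funD => //; apply: measurable_funM.
  have bNh b : bounded_fun (fun x : borel X => N%:R * h x + b).
    exists (N%:R + `|b|) => x; apply: le_trans (ler_normD _ _) _.
    by rewrite lerD2r normrM normr_nat ler_piMr.
  have lower : N%:R * \int[q]_x h x <= \sum_(i < N) fine (q (A i)).
    rewrite -[leLHS]addr0 -Rintegral_affine// -Rintegral_sum_indic//.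
    apply: le_Rintegral => //.
    - exact: (bounded_integrable q (mNh 0) (bNh 0)).
    - exact: (sum_indic_integrable q N mA).
    - move=> x _; rewrite addr0 sE; case: (st x) => + _ _; apply: le_trans.
      by rewrite le_min lexx ler_piMr//; case/andP: (h01 x).
  have upper j : \sum_(i < N) fine (p j (A i)) <= N%:R * \int[p j]_x h x + 1.
    rewrite -Rintegral_affine// -Rintegral_sum_indic//.
    apply: le_Rintegral => //.
    - exact: (sum_indic_integrable (p j) N mA).
    - exact: (bounded_integrable (p j) (mNh 1) (bNh 1)).
    - by move=> x _; rewrite sE; case: (st x).
  apply: le_trans lower _.
  apply: (@le_trans _ _ (\sum_(i < N) lam (A i))).
    by apply: ler_sum => i _; exact: qlam.
  have cs : \sum_(i < N) fine (p j (A i)) @[j --> U] --> \sum_(i < N) lam (A i).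
    by apply: cvg_big => [|i _]; [exact: add_continuous|exact: lamP].
  have cL : N%:R * \int[p j]_x h x + 1 @[j --> U] --> N%:R * L + 1.
    apply: cvgD; last exact: cvg_cst.
    by apply: cvgM; [exact: cvg_cst|exact: (cvgp _ 1)].
  by apply: (ler_cvg_to cs cL); apply: nearW.
have cvg01 (h : X -> R) : continuous h -> (forall x, 0 <= h x <= 1) ->
    \int[p j]_x h x @[j --> U] --> \int[q]_x h x.
  move=> ch h01.
  have mh := continuous_borel ch.
  have hb x : `|h x| <= 1 by case/andP: (h01 x) => ? ?; rewrite ger0_norm.
  have bh : bounded_fun h by exists 1.
  have cp := cvgp _ _ mh hb.
  suff -> : \int[q]_x h x = lim (\int[p j]_x h x @[j --> U]) by [].
  apply/eqP; rewrite eq_le le_lim//=.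
  have := le_lim (fun x => (-1) * h x + 1).
  rewrite Rintegral_affine//.
  rewrite (_ : (fun j => _) = (fun j => -1 * \int[p j]_x h x + 1)); last first.
    by apply/funext => j; rewrite Rintegral_affine.
  have -> : lim (-1 * \int[p j]_x h x + 1 @[j --> U]) =
      -1 * lim (\int[p j]_x h x @[j --> U]) + 1.
    apply: cvg_lim => //; apply: cvgD; last exact: cvg_cst.
    by apply: cvgM => //; exact: cvg_cst.
  rewrite lerD2r !mulN1r lerN2; apply.
    move=> x; apply: cvgD; last exact: cvg_cst.
    by apply: cvgM; [exact: cvg_cst|exact: ch].
  by move=> x; have := h01 x; lra.
move=> h [ch [B hB]].
(* The summand 1 keeps [C] positive; [u] is [(h + C) / (2 C)], with values in [[0, 1]]. *)
pose C := `|B| + 1; have C0 : 0 < 2 * C by have := normr_ge0 B; rewrite /C; lra.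
have hC x : `|h x| <= C.
  by rewrite (le_trans (hB x))// (le_trans (ler_norm B))// lerDl.
pose u x := (2 * C)^-1 * h x + 2^-1.
have hE x : h x = (2 * C) * u x + - C.
  by rewrite /u mulrDr mulVKf ?gt_eqF//; lra.
have cu : continuous u.
  move=> x; apply: cvgD; last exact: cvg_cst.
  by apply: cvgM; [exact: cvg_cst|exact: ch].
have u01 x : 0 <= u x <= 1.
  have := hC x; rewrite hE ler_norml.
  by rewrite lerBrDl subrr pmulr_rge0// => /andP[-> /=]; rewrite lerBlDr; nra.
have mu := continuous_borel cu.
have bu : bounded_fun u by exists 1 => x; case/andP: (u01 x) => ? ?; rewrite ger0_norm.
have E (r : probability (borel X) R) : \int[r]_x h x = (2 * C) * \int[r]_x u x + - C.
  by rewrite -Rintegral_affine//; apply: eq_Rintegral => x _; exact: hE.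
rewrite E; under eq_fun do rewrite E.
apply: cvgD; last exact: cvg_cst.
by apply: cvgM; [exact: cvg_cst|exact: cvg01].
Qed.

End tight_ultralimit.

(** * Convergence uniformly on compact sets *)

Section average.
Context d (T : measurableType d) (R : realType) (p : nat -> probability T R).

(** Integrals against the scaled sum of measures are split for the nonnegative function
    [1 * h x + B], whose form fits [Rintegral_affine]; the shift [B] is cancelled beforehand. *)
Lemma average_probability n : (0 < n)%N -> exists q : probability T R,
  (forall A, q A = (n%:R^-1)%:E * \sum_(k < n) p k A)%E /\
  (forall h : T -> R, measurable_fun setT h -> bounded_fun h ->
    \int[q]_x h x = n%:R^-1 * \sum_(k < n) \int[p k]_x h x).
Proof.
move=> n0; have r0 : 0 <= n%:R^-1 :> R by rewrite invr_ge0.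
have nn0 : n%:R != 0 :> R by rewrite pnatr_eq0 -lt0n.
pose m := mscale (NngNum r0) (msum p n).
have [|q qE] := @measure_probability _ _ _ m.
  rewrite /m /= /mscale /= /msum /=.
  under eq_bigr do rewrite probability_setT.
  by rewrite sumEFin -EFinM sumr_const card_ord mulVf.
exists q; split=> [A|h mh bh]; first by rewrite -qE.
have [B hB] := bh.
have gE x : (0 <= (1 * h x + B)%:E)%E.
  by have := hB x; rewrite lee_fin ler_norml => /andP[]; lra.
have mg : measurable_fun setT (fun x => 1 * h x + B).
  by apply: measurable_funD => //; apply: measurable_funM.
have bg : bounded_fun (fun x => 1 * h x + B).
  exists (B + `|B|) => x; rewrite mul1r; apply: le_trans (ler_normD _ _) _.
  by rewrite lerD2r.
apply: (@addIr _ B); rewrite -{1}[X in X + _]mul1r -Rintegral_affine//.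
rewrite {1}/Rintegral -qE ge0_integral_mscale//=; last exact/measurable_EFinP.
rewrite ge0_integral_measure_sum//=; last exact/measurable_EFinP.
under eq_bigr => k _ do rewrite -EFin_Rintegral// Rintegral_affine// mul1r.
rewrite sumEFin -EFinM/= big_split/= sumr_const card_ord mulrDr; congr (_ + _).
by rewrite -[B *+ n]mulr_natl mulKf.
Qed.

End average.

Section unique_ergodicity.
Context {R : realType} {G X : pseudoPMetricType R}.
Variables (act : G -> X -> X) (mu : probability (borel G) R).
Hypothesis cact : continuous (fun p : G * X => act p.1 p.2).
Hypothesis scX : sigma_compact X.
Hypothesis hX : hausdorff_space X.

Local Notation P := (markov_op act mu).

Definition cesaro (h : X -> R) n x : R := n%:R^-1 * \sum_(k < n) iter k P h x.

Lemma cesaro_bound h B n x : bcont h -> (forall x, `|h x| <= B) ->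
  `|cesaro h n x| <= B.
Proof.
move=> bh hB; have B0 : 0 <= B by apply: le_trans (hB x).
rewrite normrM ger0_norm ?invr_ge0//.
have [->|n0] := posnP n; first by rewrite invr0 mul0r.
rewrite ler_pdivrMl ?ltr0n//; apply: le_trans (ler_norm_sum _ _ _) _.
rewrite mulr_natl -[X in B *+ X]card_ord -sumr_const.
by apply: ler_sum => k _; exact: iter_markov_op_bound.
Qed.

(** Telescoping: for bounded continuous [h] the averages are invariant under [P] up to [O(1/n)],
    which makes their limits stationary. *)
Lemma cesaro_markov_op h n x :
  cesaro (P h) n x - cesaro h n x = n%:R^-1 * (iter n P h x - h x).
Proof.
rewrite /cesaro -mulrBr -sumrB; congr (_ * _).
under eq_bigr do rewrite -iterSr.
by rewrite -(big_mkord xpredT (fun k => iter k.+1 P h x - iter k P h x)) telescope_sumr.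
Qed.

Variable mX : probability (borel X) R.
Hypothesis uerg : uniquely_ergodic act mu mX.
Hypothesis recur : loc_unif_recurrent_on_average act mu.

Lemma cesaro_locally_uniform (h : X -> R) (K : set X) (e : R) : bcont h ->
  compact K -> 0 < e -> exists n0, forall n, (n0 <= n)%N -> forall x, K x ->
  `|cesaro h n x - \int[mX]_y h y| < e.
Proof.
move=> bh cK e0; apply: contrapT => no.
(* Negating uniformity beyond [j.+1] gives offending times larger than [j]: they are positive and
   tend to infinity. *)
have wit j : exists nx : nat * X, [/\ (j < nx.1)%N, K nx.2 &
    ~ `|cesaro h nx.1 nx.2 - \int[mX]_y h y| < e].
  apply: contrapT => noj; apply: no; exists j.+1 => n jn x Kx.
  by apply: contrapT => ge; apply: noj; exists (n, x).
have [nx nxP] := choice wit.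
pose rp := rwp mu cact scX.
have avg j : exists q : probability (borel X) R,
    (forall A, q A = ((nx j).1%:R^-1)%:E * \sum_(k < (nx j).1) rp k (nx j).2 A)%E /\
    (forall u : X -> R, bcont u -> \int[q]_x u x = cesaro u (nx j).1 (nx j).2).
  have [|q [qA qI]] := @average_probability _ _ _ (fun k => rp k (nx j).2) (nx j).1.
    by case: (nxP j) => + _ _; exact: leq_trans.
  exists q; split => // u bu; rewrite qI//.
  - by congr (_ * _); apply: eq_bigr => k _; exact: Rintegral_rwp.
  - exact: bcont_measurable.
  - by case: bu.
have [p pP] := choice avg.
(* [U] refines the filter [\oo], so eventual statements and sequential limits pass to [U]. *)
have [U [UU ooU]] := ultraFilterLemma (@eventually_filter).
have tight (d : R) : 0 < d -> exists2 M : set X, compact M &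
    \forall j \near U, 1 - d <= fine (p j M).
  move=> d0; have [n0 [M [cM n0M]]] := recur cK d0.
  exists M => //; apply: ooU; exists n0 => // j /= n0j.
  have [jn Kx _] := nxP j.
  have := n0M (nx j).1 (ltnW (leq_ltn_trans n0j jn)) (nx j).2 Kx.
  rewrite -lee_fin fineK ?fin_num_measure//; last exact: compact_borel.
  rewrite (pP j).1.
  under [X in (_ <= _ * X)%E -> _]eq_bigr do rewrite (rwpE mu cact scX).
  exact.
have FU : ProperFilter U by exact: ultra_proper.
have [q qlim] := tight_ultralimit hX UU tight.
have stat u : bcont u -> \int[q]_x P u x = \int[q]_x u x.
  move=> bu; have bPu : bcont (P u) by exact: markov_op_feller.
  apply/eqP; rewrite -subr_eq0; apply/eqP.
  have l1 : (\int[p j]_x P u x - \int[p j]_x u x) @[j --> U] -->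
      \int[q]_x P u x - \int[q]_x u x by apply: cvgB; exact: qlim.
  rewrite -(cvg_lim (@Rhausdorff R) l1); apply: cvg_lim => //.
  have [_ [B uB]] := bu.
  suff l2 : (fun j => \int[p j]_x P u x - \int[p j]_x u x) @ \oo --> 0.
    by apply: cvg_trans l2; exact: cvg_app.
  apply: norm_cvg0.
  (* The time in [nx j] is at least [j.+1], so the difference is at most [2 * B / j.+1], that is,
     [2 * B * harmonic j]. *)
  apply: (@squeeze_cvgr _ _ _ _ (cst 0) (fun j => 2 * B * harmonic j)).
  - apply: nearW => j /=; rewrite normr_ge0/= !(pP j).2// cesaro_markov_op.
    have [jn _ _] := nxP j; rewrite normrM ger0_norm ?invr_ge0// mulrC.
    apply: ler_pM => //.
    + apply: le_trans (ler_normB _ _) _; rewrite mulr_natl mulr2n; apply: lerD => //.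
      exact: iter_markov_op_bound.
    + by rewrite lef_pV2 ?posrE ?ltr0n// ?ler_nat//; exact: leq_trans jn.
  - exact: cvg_cst.
  - by rewrite -[X in _ --> X](mulr0 (2 * B)); apply: cvgM;
      [exact: cvg_cst|exact: cvg_harmonic].
have [q' q'E] := conv_probability mu cact scX q.
have qm : forall A : set (borel X), measurable A -> q A = mX A.
  (* [stat] concerns integrals of bounded continuous functions; [bcont_determines] upgrades it to
     equality of measures, as stationarity demands. *)
  apply: uerg => A mA; rewrite q'E; apply: bcont_determines => // u bu.
  by rewrite (Rintegral_conv cact scX q'E bu) stat.
have qh : \int[q]_x h x = \int[mX]_x h x.
  by congr fine; apply: eq_measure_integral => A mA _; exact: qm.
(* For some [j] the average at [nx j] is then within [e] of the integral against [mX], contrary to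
   the choice of [nx j]. *)
have := qlim _ bh; rewrite qh => /cvgrPdist_lt /(_ e e0) /filter_ex[j].
rewrite (pP j).2// distrC; have [_ _] := nxP j; exact.
Qed.

End unique_ergodicity.

(** * Lyapunov drift *)

Section bcont_sums.
Context {R : realType} {X : pseudoPMetricType R}.

Lemma bcont_sum (h : nat -> X -> R) m : (forall k, bcont (h k)) ->
  bcont (fun x => \sum_(k < m) h k x).
Proof.
move=> bh; elim: m => [|m [cs [B sB]]].
  under eq_fun do rewrite big_ord0.
  by split; [move=> x; exact: cvg_cst|exists 0 => x; rewrite normr0].
under eq_fun do rewrite big_ord_recr/=.
have [ch [B' hB]] := bh m; split.
  by move=> x; apply: cvgD; [exact: cs|exact: ch].
by exists (B + B') => x; apply: le_trans (ler_normD _ _) _; exact: lerD.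
Qed.

Lemma Rintegral_bcont_sum (p : probability (borel X) R) (h : nat -> X -> R) m :
  (forall k, bcont (h k)) ->
  \int[p]_x (\sum_(k < m) h k x) = \sum_(k < m) \int[p]_x h k x.
Proof.
move=> bh; elim: m => [|m IH].
  under eq_Rintegral do rewrite big_ord0.
  by rewrite probability_Rintegral_cst big_ord0.
under eq_Rintegral do rewrite big_ord_recr/=.
rewrite RintegralD//; first by rewrite IH big_ord_recr.
- have bs := bcont_sum m bh.
  by apply: (bounded_integrable p (bcont_measurable bs)); case: bs.
- by apply: (bounded_integrable p (bcont_measurable (bh m))); case: (bh m).
Qed.

End bcont_sums.

Section lyapunov_drift.
Context {R : realType} {G X : pseudoPMetricType R}.
Variables (act : G -> X -> X) (mu : probability (borel G) R).
Hypothesis cact : continuous (fun p : G * X => act p.1 p.2).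
Hypothesis scX : sigma_compact X.
Variables (V : X -> R) (a b : R).
Hypothesis cV : continuous V.
Hypothesis V0 : forall x, 0 <= V x.
Hypothesis a01 : 0 <= a < 1.
Hypothesis b0 : 0 <= b.
Hypothesis drift : forall x, (\int[mu]_g (V (act g x))%:E <= (a * V x + b)%:E)%E.

Local Notation P := (markov_op act mu).
Local Notation rwp := (rwp mu cact scX).

Let mV : measurable_fun setT ((fun x => (V x)%:E) : borel X -> \bar R).
Proof. by apply/measurable_EFinP; exact: continuous_borel. Qed.

(** [b / (1 - a)] is the fixed point of [t |-> a * t + b], so one more step only multiplies the term
    with [V x] by [a]. *)
Lemma lyapunov_rw k x :
  (\int[rwp k x]_y (V y)%:E <= (a ^+ k * V x + b / (1 - a))%:E)%E.
Proof.
have /andP[a0 a1] := a01; have na1 : 1 - a != 0 by rewrite subr_eq0 gt_eqF.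
have b'0 : 0 <= b / (1 - a) by rewrite divr_ge0// subr_ge0 ltW.
elim: k => [|k IH].
  rewrite -rwpE /= (_ : (fun A => _) = dirac (x : borel X))//.
  by rewrite integral_dirac//= diracT mul1e lee_fin expr0 mul1r lerDl.
rewrite -(rwpE mu cact scX k.+1) /= (rwpE mu cact scX k).
rewrite (ge0_integral_conv mu cact scX _ mV)//.
apply: (@le_trans _ _ (\int[rwp k x]_y (a%:E * (V y)%:E + b%:E))%E).
  apply: ge0_le_integral => //=.
  - by move=> y _; apply: integral_ge0 => g _; rewrite lee_fin.
  - by apply: (measurable_integral_act mu cact scX mV) => z; rewrite lee_fin.
  - by apply: emeasurable_funD => //; exact: measurable_funeM.
rewrite ge0_integralD//=; last 2 first.
- by move=> y _; rewrite mule_ge0// lee_fin.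
- exact: measurable_funeM.
rewrite ge0_integralZl_EFin//; last by move=> y _; rewrite lee_fin.
rewrite integral_cst//= probability_setT mule1.
apply: (@le_trans _ _ (a%:E * (a ^+ k * V x + b / (1 - a))%:E + b%:E)%E).
  by apply: leeD => //; apply: lee_pmul => //;
    apply: integral_ge0 => y _; rewrite lee_fin.
rewrite -EFinM -EFinD lee_fin exprS -mulrA mulrDr -addrA lerD2l.
by rewrite le_eqVlt; apply/orP; left; apply/eqP; field.
Qed.

(** The first [N] terms are each within [2 * B] of [l]. The last [m] form an average restarted from
    the law [rwp N x]: its error is at most [e] where [V <= L], and the rest is controlled by
    Markov's inequality. *)
Lemma cesaro_lyapunov_bound (f : X -> R) (B l L e C : R) N m x :
  bcont f -> (forall y, `|f y| <= B) -> `|l| <= B -> 0 < L -> 0 <= e ->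
  (forall y, V y <= L -> `|cesaro act mu f m y - l| <= e) ->
  (\int[rwp N x]_y (V y)%:E <= C%:E)%E -> (0 < m)%N ->
  `|cesaro act mu f (N + m) x - l| <=
    2 * B * (N%:R / (N + m)%:R) + (e + 2 * B / L * C).
Proof.
move=> bf fB lB L0 e0 small VC m0.
have B0 : 0 <= B by apply: le_trans lB.
have iB k y : `|iter k P f y| <= B by exact: iter_markov_op_bound.
have cB y : `|cesaro act mu f m y| <= B by exact: cesaro_bound.
have [n0 m0'] : 0 < (N + m)%:R :> R /\ 0 < m%:R :> R by rewrite !ltr0n addn_gt0 m0 orbT.
pose u y := cesaro act mu f m y - l.
have mu_sum y : m%:R * u y = \sum_(k < m) (iter k P f y - l).
  rewrite /u mulrBr /cesaro mulVKf ?gt_eqF// sumrB sumr_const card_ord.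
  by rewrite -[l *+ m]mulr_natl.
have bterm k : bcont (fun y => iter k P f y - l).
  have [ci _] := iter_markov_op_bcont mu cact k bf; split.
    by move=> y; apply: cvgB; [exact: ci|exact: cvg_cst].
  by exists (B + B) => y; apply: le_trans (ler_normB _ _) _; exact: lerD.
have bmu : bcont (fun y => m%:R * u y).
  by under eq_fun do rewrite mu_sum; exact: (bcont_sum m bterm).
have tail : \sum_(k < m) (iter (N + k) P f x - l) = \int[rwp N x]_y (m%:R * u y).
  under [RHS]eq_Rintegral do rewrite mu_sum.
  rewrite (Rintegral_bcont_sum _ _ bterm); apply: eq_bigr => k _.
  rewrite (_ : \int[rwp N x]_y (iter k P f y - l) =
               \int[rwp N x]_y (1 * iter k P f y + - l)); last first.
    by apply: eq_Rintegral => y _; rewrite mul1r.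
  have bk := iter_markov_op_bcont mu cact k bf.
  rewrite Rintegral_affine ?mul1r; [|exact: bcont_measurable|by case: bk].
  by rewrite Rintegral_rwp// iterD.
(* Markov's inequality in pointwise form: where [V y] exceeds [L], the trivial bound [2 * B] is at
   most [2 * B / L * V y]. *)
have uV y : `|m%:R * u y| <= m%:R * e + m%:R * (2 * B / L) * V y.
  rewrite normrM normr_nat -mulrA -mulrDr ler_pM2l//.
  have [VL|LV] := leP (V y) L.
    by apply: le_trans (small y VL) _; rewrite lerDl !mulr_ge0// invr_ge0 ltW.
  apply: (@le_trans _ _ (2 * B)).
    by apply: le_trans (ler_normB _ _) _; have := cB y; lra.
  apply: (@le_trans _ _ (2 * B / L * V y)); last by rewrite lerDr.
  by rewrite mulrAC ler_pdivlMr// ler_wpM2l ?mulr_ge0// ltW.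
have tailB : `|\int[rwp N x]_y (m%:R * u y)| <= m%:R * (e + 2 * B / L * C).
  have mmu := bcont_measurable bmu.
  have imu := bounded_integrable (rwp N x) mmu bmu.2.
  rewrite -lee_fin EFin_normr_Rintegral//.
  apply: le_trans (le_abse_integral _ _ _) _ => //; first exact/measurable_EFinP.
  apply: (@le_trans _ _ (\int[rwp N x]_y
      ((m%:R * e)%:E + (m%:R * (2 * B / L))%:E * (V y)%:E))%E).
    apply: ge0_le_integral => //=.
    - by do 2 apply: measurableT_comp => //.
    - by apply: emeasurable_funD => //; exact: measurable_funeM.
    - by move=> y _; rewrite -EFinM -EFinD lee_fin.
  have c0 : 0 <= m%:R * (2 * B / L) by rewrite !mulr_ge0// invr_ge0 ltW.
  rewrite ge0_integralD//=; last 3 first.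
  - by move=> y _; rewrite lee_fin mulr_ge0.
  - by move=> y _; rewrite -EFinM lee_fin mulr_ge0.
  - exact: measurable_funeM.
  rewrite ge0_integralZl_EFin//; last by move=> y _; rewrite lee_fin.
  rewrite integral_cst//= probability_setT mule1.
  apply: (@le_trans _ _ ((m%:R * e)%:E + (m%:R * (2 * B / L))%:E * C%:E)%E).
    by apply: leeD => //; apply: lee_pmul => //;
    apply: integral_ge0 => y _; rewrite lee_fin.
  by rewrite -EFinM -EFinD lee_fin mulrDr !mulrA.
have -> : cesaro act mu f (N + m) x - l =
    (N + m)%:R^-1 * (\sum_(k < N) (iter k P f x - l) +
                     \sum_(k < m) (iter (N + k) P f x - l)).
  apply: (mulfI (lt0r_neq0 n0)); rewrite mulrBr /cesaro !mulVKf ?gt_eqF//.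
  rewrite !sumrB !sumr_const !card_ord addrACA -opprD -mulrnDr mulr_natl.
  by rewrite big_split_ord.
rewrite normrM ger0_norm ?invr_ge0// ler_pdivrMl// mulrDr.
apply: le_trans (ler_normD _ _) _; apply: lerD.
  rewrite mulrCA [_%:R * (_ / _)]mulrC divfK ?gt_eqF//.
  apply: le_trans (ler_norm_sum _ _ _) _.
  rewrite mulr_natr -[X in _ *+ X]card_ord -sumr_const; apply: ler_sum => k _.
  by apply: le_trans (ler_normB _ _) _; have := iB k x; lra.
rewrite tail; apply: le_trans tailB _; apply: ler_wpM2r; last first.
  by rewrite ler_nat leq_addl.
have C0 : 0 <= C.
  by rewrite -lee_fin; apply: le_trans VC; apply: integral_ge0 => y _; rewrite lee_fin.
by rewrite addr_ge0// !mulr_ge0// invr_ge0 ltW.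
Qed.

End lyapunov_drift.

(** * Sub-exponentially large starting points *)

Lemma Cc_bcont {R : realType} {X : topologicalType} (f : X -> R) :
  Cc f -> bcont f.
Proof.
move=> [cf cK]; split => //.
have /compact_bounded[M [_ MP]] : compact (f @` closure [set x | f x != 0]).
  by apply: continuous_compact => //; exact: continuous_subspaceT.
(* Every number strictly above [M] bounds the image, hence [M + 1]; the maximum with 0 covers the
   points where [f] vanishes. *)
exists (Num.max 0 (M + 1)) => x; have [->|fx] := eqVneq (f x) 0.
  by rewrite normr0 le_max lexx.
rewrite le_max; apply/orP; right; apply: (MP (M + 1)); first by rewrite ltrDl.
by exists x => //; exact: subset_closure.
Qed.

(** Eventually [ln (phi n) <= n * d], and [n <= 2 * q * (n %/ q)] once [q <= n]. The choice of [d]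
    makes [n * d] at most [- (n %/ q) * ln a], so the decay wins. *)
Lemma subexponential_decay {R : realType} (phi : nat -> R) (a : R) (q : nat) :
  (forall n, 1 <= phi n) -> subexponential phi -> 0 < a < 1 -> (0 < q)%N ->
  exists n0, forall n, (n0 <= n)%N -> a ^+ (n %/ q) * phi n <= 1.
Proof.
move=> phi1 sub /andP[a0 a1] q0.
have lna : ln a < 0 by rewrite ln_lt0// a0 a1.
have q2 : 0 < (2 * q)%:R :> R by rewrite ltr0n muln_gt0.
pose d := - ln a / (2 * q)%:R.
have d0 : 0 < d by rewrite divr_gt0// oppr_gt0.
(* The upper limit is an infimum of suprema over members [W] of [\oo]; being 0, it leaves some
   supremum below [d]. *)
have [_ [W [n1 _ n1W] <-] Wd] : exists2 y,
    [set ereal_sup ((fun n => (n%:R^-1 * ln (phi n))%:E) @` W) | W in \oo] y &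
    (y < d%:E)%E.
  by apply/ereal_inf_lt; rewrite [X in (X < _)%E]sub lte_fin.
exists (maxn n1 q) => n; rewrite geq_max => /andP[n1n qn].
have n0 : 0 < n%:R :> R by rewrite ltr0n (leq_trans q0).
have lnphi : ln (phi n) <= n%:R * d.
  rewrite -ler_pdivrMl// -lee_fin; apply: le_trans (ltW Wd).
  by apply: ereal_sup_ubound; exists n => //; exact: n1W.
have nq : n%:R <= (2 * q)%:R * (n %/ q)%:R :> R.
  rewrite -natrM ler_nat; apply: ltnW; rewrite (mulnC 2) -mulnA mulnC.
  apply: leq_trans (ltn_ceil n q0) _; rewrite leq_mul2r; apply/orP; right.
  by rewrite mul2n -addnn -addn1 leq_add2l divn_gt0.
have phi0 : 0 < phi n by apply: lt_le_trans (phi1 n).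
rewrite -[phi n]lnK ?posrE// -[a]lnK ?posrE// -expRM_natl -expRD -[leRHS]expR0 ler_expR.
apply: (@le_trans _ _ ((n %/ q)%:R * ln a + n%:R * d)).
  by rewrite lerD2l.
apply: (@le_trans _ _ ((n %/ q)%:R * ln a + (2 * q)%:R * (n %/ q)%:R * d)).
  by rewrite lerD2l ler_wpM2r// ltW.
rewrite /d mulrAC [(2 * q)%:R * _]mulrC divfK ?gt_eqF//.
by rewrite mulNr mulrC subrr.
Qed.

Lemma half_split (n N k : nat) : (2 * N <= n)%N -> ((2 * k).+2 <= n)%N ->
  [/\ n = (N + (n - N))%N, (k <= n - N)%N, (0 < n - N)%N & (0 < n)%N].
Proof. by move=> ? ?; split; lia. Qed.

Theorem theorem4p13 (R : realType)
  (G : pseudoPMetricType R) (mul : G -> G -> G) (inv : G -> G) (one : G)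
  (X : pseudoPMetricType R) (act : G -> X -> X)
  (mX : probability (g_sigma_algebraType (@open X)) R)
  (mu : probability (g_sigma_algebraType (@open G)) R)
  (V : X -> R) (phi : nat -> R) (f : X -> R) :
  (* standing assumptions on G *)
  topological_group mul inv one -> hausdorff_space G ->
  loc_compact G -> sigma_compact G ->
  (* standing assumptions on X *)
  hausdorff_space X -> loc_compact X -> sigma_compact X ->
  (* ergodic measure-preserving continuous action *)
  continuous_action mul one act ->
  invariant_measure act mX -> ergodic_action act mX ->
  (* hypotheses of the theorem *)
  uniquely_ergodic act mu mX ->
  loc_unif_recurrent_on_average act mu ->
  lyapunov act mu V ->
  (forall n, 1 <= phi n) -> subexponential phi ->
  Cc f ->
  (fun n : nat =>
     ereal_sup ([set 0%E] `|`
       [set `| ((n%:R)^-1)%:E *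
               (\sum_(k < n) \int[rw act mu k x]_(y in [set: g_sigma_algebraType (@open X)]) (f y)%:E)
             - \int[mX]_(y in [set: g_sigma_algebraType (@open X)]) (f y)%:E |%E
        | x in [set x : X | V x <= phi n]]))
    @ \oo --> 0%E.
Proof.
move=> _ _ _ _ hX _ scX [_ _ cact] _ _ uerg recur.
move=> [pV cV V0 [alpha [beta [al1 be0 dr]]]] phi1 sub fCc.
have bf := Cc_bcont fCc; have [_ [B fB]] := bf.
have B0 : 0 <= B by apply: le_trans (fB point).
(* The maximum with [1/2] makes the rate positive, as [subexponential_decay] requires. [c] bounds
   the mean of [V] after [N] steps once [a ^+ N * phi n <= 1]. *)
pose a := Num.max alpha 2^-1; pose c := 1 + beta / (1 - a).
have a0 : 0 < a by rewrite lt_max invr_gt0 ltr0n orbT.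
have a1 : a < 1 by rewrite gt_max al1 invf_lt1// ltr1n.
have a01 : 0 <= a < 1 by rewrite a1 ltW.
have c0 : 0 < c.
  by rewrite ltr_wpDr// divr_ge0// subr_ge0 ltW.
have drift x : (\int[mu]_g (V (act g x))%:E <= (a * V x + beta)%:E)%E.
  apply: le_trans (dr x) _; rewrite lee_fin lerD2r ler_wpM2r//.
  by rewrite le_max lexx.
pose l := \int[mX]_y f y.
have lB : `|l| <= B by apply: Rintegral_bound => //; exact: bcont_measurable.
have termE n x : ((n%:R^-1)%:E *
    (\sum_(k < n) \int[rw act mu k x]_(y in [set: g_sigma_algebraType (@open X)]) (f y)%:E)
     - \int[mX]_(y in [set: g_sigma_algebraType (@open X)]) (f y)%:E)%E =
    (cesaro act mu f n x - l)%:E.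
  have mf := bcont_measurable bf.
  rewrite EFinB -EFin_Rintegral//; last by case: bf.
  congr (_ - _)%E; rewrite /cesaro EFinM -sumEFin; congr (_ * _)%E.
  apply: eq_bigr => k _; rewrite (rwpE mu cact scX) -EFin_Rintegral//.
    by rewrite Rintegral_rwp.
  by case: bf.
set S := fun n : nat => ereal_sup _.
(* The added point 0 sets the supremum to 0 when no [x] satisfies [V x <= phi n]; it would otherwise
   be [-oo]. *)
have S0 n : (0 <= S n)%E by apply: ereal_sup_ubound; left.
have Sle (e : R) : 0 < e -> \forall n \near \oo, (S n <= e%:E)%E.
  move=> e0; pose e3 := e / 3; have e30 : 0 < e3 by rewrite divr_gt0.
  (* Chosen to give [2 * B / L * c <= e3]; the summand 1 keeps [L] positive when [B] is 0. *)
  pose L := (2 * B + 1) * c / e3.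
  have L0 : 0 < L by rewrite divr_gt0// mulr_gt0// ltr_wpDl// mulr_ge0.
  have cK : compact [set x | V x <= L].
    have := pV _ (@segment_compact R 0 L); congr compact.
    by apply/seteqP; split => x /=; rewrite in_itv/= V0.
  have [n0 n0P] := cesaro_locally_uniform cact scX hX uerg recur bf cK e30.
  (* The first [n %/ q] terms weigh at most [1/q], costing [2 * B / q]; [1 < q] keeps them within
     the first half of the times. *)
  have [q [q1 qB]] : exists q : nat, (1 < q)%N /\ 2 * B / q%:R <= e3.
    exists (Num.truncn (2 * B / e3)).+2; split => //.
    rewrite ler_pdivrMr ?ltr0n// [e3 * _]mulrC -ler_pdivrMr//.
    apply: (@le_trans _ _ (Num.truncn (2 * B / e3)).+1%:R); last by rewrite ler_nat.
    by apply: ltW; apply: truncnS_gt.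
  have [n1 n1P] := subexponential_decay phi1 sub (introT andP (conj a0 a1)) (ltnW q1).
  (* From [n >= 2 * n0 + 2] and [2 * N <= n] follow [n0 <= m] and [0 < m]. *)
  exists (maxn n1 (2 * n0).+2) => // n /=; rewrite geq_max => /andP[n1n n0n].
  apply: ge_ereal_sup => _ [->|[x /= Vx <-]]; first by rewrite lee_fin ltW.
  rewrite termE lee_fin.
  pose N := (n %/ q)%N; pose m := (n - N)%N.
  have N2 : (2 * N <= n)%N.
    by rewrite mulnC (leq_trans _ (leq_divM n q))// leq_mul2l q1 orbT.
  have [nE n0m m0 n_gt0] := half_split N2 n0n.
  have VN : (\int[rwp mu cact scX N x]_y (V y)%:E <= c%:E)%E.
    apply: le_trans (lyapunov_rw cact scX cV V0 a01 be0 drift N x) _.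
    rewrite lee_fin /c lerD2r; apply: le_trans (n1P n n1n).
    by rewrite ler_wpM2l// exprn_ge0// ltW.
  have small y : V y <= L -> `|cesaro act mu f m y - l| <= e3.
    by move=> Vy; apply: ltW; exact: n0P.
  rewrite [in X in X <= _]nE.
  apply: le_trans (cesaro_lyapunov_bound cV V0 bf fB lB L0 (ltW e30) small VN m0) _.
  have h1 : 2 * B * (N%:R / (N + m)%:R) <= e3.
    apply: le_trans qB; rewrite ler_wpM2l ?mulr_ge0// -nE.
    rewrite ler_pdivrMr ?ltr0n// mulrC ler_pdivlMr ?ltr0n ?(ltnW q1)//.
    by rewrite -natrM ler_nat leq_divM.
  have h2 : 2 * B / L * c <= e3.
    rewrite mulrAC ler_pdivrMr// /L mulrCA divff ?gt_eqF// mulr1.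
    by rewrite ler_wpM2r ?lerDl// ltW.
  by rewrite -(_ : e3 + (e3 + e3) = e) ?lerD//; rewrite /e3; field.
apply/fine_cvgP; split.
  near=> n; rewrite ge0_fin_numE//.
  by apply: (@le_lt_trans _ _ 1%:E); [near: n; exact: Sle|exact: ltry].
apply/cvgr0Pnorm_le => e e0; near=> n => /=.
have Sn : (S n <= e%:E)%E by near: n; exact: Sle.
have Sf : S n \is a fin_num by rewrite ge0_fin_numE// (le_lt_trans Sn)// ltry.
by rewrite ger0_norm ?fine_ge0// -lee_fin fineK.
Unshelve. all: by end_near.
Qed.
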